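(* Let $G$ be a finite simple graph of treewidth $k$ and maximum degree $\Delta$ with $\Delta \geq k + \sqrt{k}$. Then the fractional chromatic index of $G$ satisfies $\chi'_f(G) = \Delta$.
   Context: All graphs are finite and simple. The fractional chromatic index of a graph $G$ is $$\chi'_f(G) = \min\left\{ \sum_{M\in\mathcal{M}} \lambda_M \; : \; \lambda_M \in \mathbb{R}_{+},\ \sum_{M\in\mathcal{M},\, e\in M} \lambda_M = 1 \ \text{ for all } e\in E(G)\right\},$$ where $\mathcal{M}$ is the collection of all matchings in $G$ and $\mathbb{R}_+$ denotes the nonnegative reals. A tree-decomposition of $G$ consists of a tree $T$ and a collection of bags $B_t \subseteq V(G)$, $t\in V(T)$, such that (i) $V(G)=\bigcup_{t\in V(T)} B_t$; (ii) for each edge $vw\in E(G)$ there is $t\in V(T)$ with $v,w\in B_t$; (iii) if $v\in B_s\cap B_t$ then $v\in B_r$ for every vertex $r$ on the path connecting $s$ and $t$ in $T$. It has width $k$ if each bag has size at most $k+1$. The treewidth of $G$ is the smallest integer $k$ for which there is a width $k$ tree-decomposition of $G$. *)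

(* Defs.v *)
From mathcomp Require Import all_boot all_order all_algebra.
From mathcomp Require Import boolp reals.

Set Implicit Arguments.
Unset Strict Implicit.
Unset Printing Implicit Defensive.
Import Order.TTheory GRing.Theory Num.Theory.

Local Open Scope ring_scope.

Record sgraph := SGraph {
  vertex :> finType;
  adj : rel vertex;
  adj_sym : symmetric adj;
  adj_irrefl : irreflexive adj
}.

Definition degree (G : sgraph) (v : G) : nat := #|[set w | adj v w]|.

Definition max_degree (G : sgraph) : nat := \max_(v : G) degree v.

Definition edges (G : sgraph) : {set {set G}} :=
  [set e : {set G} | [exists v, exists w, adj v w && (e == [set v; w])]].

Definition matchings (G : sgraph) : {set {set {set G}}} :=
  [set M : {set {set G}} | (M \subset edges G) && trivIset M].

Definition fractional_edge_coloring (R : realType) (G : sgraph)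
    (lam : {set {set G}} -> R) : Prop :=
  (forall M, M \in matchings G -> 0 <= lam M) /\
  (forall e, e \in edges G -> \sum_(M in matchings G | e \in M) lam M = 1).

(* [x] is the minimum, attained by some [lam], of the total weight. *)
Definition is_fractional_chromatic_index (R : realType) (G : sgraph) (x : R) :
    Prop :=
  (exists lam : {set {set G}} -> R, fractional_edge_coloring lam /\
     \sum_(M in matchings G) lam M = x) /\
  (forall lam : {set {set G}} -> R, fractional_edge_coloring lam ->
     x <= \sum_(M in matchings G) lam M).

Definition is_tree (T : sgraph) : Prop :=
  [/\ (0 < #|T|)%N,
      forall s t : T, connect (@adj T) s t
    & forall c : seq T, (2 < size c)%N -> ~ ucycle (@adj T) c].

Definition is_tree_decomposition (G T : sgraph) (B : T -> {set G}) : Prop :=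
  [/\ is_tree T,
      forall v : G, exists t : T, v \in B t,
      forall v w : G, adj v w -> exists t : T, v \in B t /\ w \in B t
    & forall (v : G) (s t r : T) (p : seq T),
        v \in B s -> v \in B t ->
        path (@adj T) s p -> uniq (s :: p) -> last s p = t ->
        r \in s :: p -> v \in B r].

Definition has_tree_decomposition_of_width (G : sgraph) (k : nat) : Prop :=
  exists (T : sgraph) (B : T -> {set G}),
    is_tree_decomposition B /\ forall t : T, (#|B t| <= k.+1)%N.

Definition single_vertex_graph : sgraph :=
  @SGraph unit (fun _ _ => false) (fun _ _ => erefl) (fun _ => erefl).

Lemma exists_tree_decomposition (G : sgraph) :
  exists k, `[< has_tree_decomposition_of_width G k >].
Proof.
exists #|G|; apply/asboolP.
exists single_vertex_graph, (fun _ => [set: G]); split; last first.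
  by move=> _; rewrite cardsT.
split.
- split; first by rewrite card_unit.
  + by case; case; apply: connect0.
  + by case=> [|? [|? c]] //= _ /andP[].
- by move=> v; exists tt; rewrite inE.
- by move=> v w _; exists tt; rewrite !inE.
- by move=> v s t r p; rewrite !inE.
Qed.

(* Widths range over [nat], so the graph with no vertex has treewidth 0. *)
Definition treewidth (G : sgraph) : nat := ex_minn (exists_tree_decomposition G).

(* Main.v *)
Require Import Defs.
From mathcomp Require Import all_boot all_order all_algebra.
From mathcomp Require Import boolp reals.
From mathcomp Require Import zify ring.

Set Implicit Arguments.
Unset Strict Implicit.
Unset Printing Implicit Defensive.
Import Order.TTheory GRing.Theory Num.Theory.

(** The lower bound is the count at a vertex of maximum degree.  For the upper
    bound write Delta = k + d, so that k <= d^2.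

    Density: every nonempty vertex set U spans at most Delta (|U| - 1) / 2
    edges.  This is trivial if |U| <= Delta.  Otherwise G[U] is a spanning
    subgraph of a k-tree, and in a k-tree on at least k + d + 1 vertices the
    truncated deficiencies (Delta - deg u)^+ add up to at least
    d (d + 1) >= Delta: equality holds on k + d + 1 vertices, and deleting the
    vertex added last, of degree k, loses d and gains one for each neighbour of
    degree less than k + d before the addition, of which there are at most d.

    Colouring: by Farkas' lemma it suffices that for all rational edge weights
    some matching carries at least 1/Delta of the total weight.  For natural
    weights this goes by induction on the total weight.  If some vertex is
    covered by every maximum weight matching, decrease the weights at that
    vertex by 1; otherwise decrease the weights of a connected component of the
    support by 1, and use that an optimal matching for the decreased weights
    can be chosen to miss at most one vertex of that component. *)

(** * k-trees *)

Section KTree.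
Variables (V : finType) (k : nat).
Implicit Types (A K Q S X : {set V}) (e : rel V).

Definition deg e (u : V) : nat := #|[set v | e u v]|.

Definition clique e K := {in K &, forall a b, a != b -> e a b}.

Definition complete_on A : rel V :=
  fun a b => [&& a \in A, b \in A & a != b].

Definition add_vertex e x Q : rel V :=
  fun a b => [|| e a b, (a == x) && (b \in Q) | (b == x) && (a \in Q)].

(* The edge-maximal graphs of treewidth at most [k]: the usual [k]-trees,
   together with the complete graphs on fewer than [k.+1] vertices. *)
Inductive ktree : {set V} -> rel V -> Prop :=
| ktree_complete A : #|A| <= k.+1 -> ktree A (complete_on A)
| ktree_add A e K x y : ktree A e -> K \subset A -> #|K| = k.+1 ->
    clique e K -> y \in K -> x \notin A ->
    ktree (x |: A) (add_vertex e x (K :\ y)).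

Lemma ktree_sub A e : ktree A e -> subrel e (complete_on A).
Proof.
elim=> {A e} [A _ //|A e K x y _ IH sKA _ _ _ xA] a b.
have sK z : z \in K :\ y -> z \in A by move=> /setD1P[_ /(subsetP sKA)].
have nx z : z \in A -> z != x by apply: contraTneq => ->.
rewrite /complete_on !inE.
case/or3P => [/IH/and3P[-> -> ->]|/andP[/eqP-> /sK bA]|/andP[/eqP-> /sK aA]].
- by rewrite !orbT.
- by rewrite bA orbT eqxx /= eq_sym nx.
- by rewrite aA orbT eqxx /= nx.
Qed.

Lemma ktree_sym A e a b : ktree A e -> e a b -> e b a.
Proof.
move=> tA; elim: tA a b => {A e} [A _|A e K x y _ IH _ _ _ _ _] a b.
  by rewrite /complete_on => /and3P[-> ->]; rewrite eq_sym.
by rewrite /add_vertex => /or3P[/IH->|->|->]; rewrite ?orbT.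
Qed.

Section Step.
Variables (A K : {set V}) (e : rel V) (x y : V).
Hypotheses (tA : ktree A e) (sKA : K \subset A) (cK : #|K| = k.+1).
Hypotheses (clK : clique e K) (yK : y \in K) (xA : x \notin A).
Let e' := add_vertex e x (K :\ y).

Let mem_neq z : z \in A -> (z == x) = false.
Proof. by apply: contraTF => /eqP ->. Qed.

Let new_notin : (x \in K :\ y) = false.
Proof. by apply: contraNF xA => /setD1P[_ /(subsetP sKA)]. Qed.

Lemma add_vertex_new b : e' x b = (b \in K :\ y).
Proof.
rewrite /e' /add_vertex eqxx new_notin andbF orbF.
by case ee: (e x b) => //; have /and3P[] := ktree_sub tA ee; rewrite (negPf xA).
Qed.

Lemma deg_add_new : deg e' x = k.
Proof.
rewrite /deg (_ : [set _ | _] = K :\ y); last first.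
  by apply/setP => b; rewrite inE add_vertex_new.
by move: (cardsD1 y K); rewrite yK cK => -[].
Qed.

Lemma deg_add_old u : u \in A -> deg e' u = deg e u + (u \in K :\ y).
Proof.
move=> uA; have ux := mem_neq uA.
rewrite /deg (_ : [set v | e' u v] =
  if u \in K :\ y then x |: [set v | e u v] else [set v | e u v]); last first.
  apply/setP=> b; rewrite inE /e' /add_vertex ux /=.
  by case: ifP => _; rewrite !inE ?andbT ?andbF ?orbF // orbC.
case: ifP => _; last by rewrite addn0.
rewrite cardsU1 inE addnC; case ee: (e u x) => //=.
by have /and3P[] := ktree_sub tA ee; rewrite (negPf xA).
Qed.

Lemma clique_add_old K' : K' \subset A -> clique e' K' <-> clique e K'.
Proof.
move=> sK'; split=> cl a b aK bK ab; have := cl a b aK bK ab.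
  by rewrite /e' /add_vertex !mem_neq ?(subsetP sK') //= orbF.
by rewrite /e' /add_vertex => ->.
Qed.

Lemma clique_add_new K' : x \in K' -> clique e' K' -> K' :\ x \subset K :\ y.
Proof.
move=> xK' cl; apply/subsetP => b /setD1P[bx bK'].
by rewrite -add_vertex_new cl // eq_sym.
Qed.

Lemma add_subset_old K' : K' \subset x |: A -> x \notin K' -> K' \subset A.
Proof.
move=> /subsetP s xK'; apply/subsetP => b bK.
have /setU1P[bx|//] := s b bK.
by rewrite -bx bK in xK'.
Qed.

End Step.

(** A clique through the new vertex [x] consists of [x] and part of [K :\ y], which has [k]
    elements. *)
Lemma ktree_clique A e K :
  ktree A e -> K \subset A -> clique e K -> #|K| <= k.+1.
Proof.
move=> tA; elim: tA K => {A e} [A cA K /subset_leq_card sK _|].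
  exact: leq_trans cA.
move=> A e K x y tA IH sKA cK clK yK xA K' sK' cl.
have [xK'|xK'] := boolP (x \in K').
  have := subset_leq_card (clique_add_new tA sKA xA xK' cl).
  rewrite (cardsD1 x K') xK'; move: (cardsD1 y K); rewrite yK cK /=; lia.
have s := add_subset_old sK' xK'.
by apply: (IH _ s); apply/(clique_add_old K e y xA s).
Qed.

Lemma ktree_deg_le A e u : ktree A e -> deg e u <= #|A :\ u|.
Proof.
move=> tA; apply/subset_leq_card/subsetP => v; rewrite !inE.
by case/(ktree_sub tA)/and3P => _ -> nuv; rewrite eq_sym nuv.
Qed.

(* In a clique tree with [#|A| - k] nodes, [deg u - k + 1] is the number of
   bags containing [u]. *)
Lemma ktree_few_low_degree A e K j : ktree A e -> K \subset A -> #|K| = k.+1 ->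
  clique e K -> j + k < #|A| -> #|[set u in K | deg e u < k + j]| <= j.
Proof.
move=> tA; elim: tA K j => {A e} [A cA K j sKA cK _ lt|].
  have j0 : j = 0 by lia.
  have KA : K = A by apply/eqP; rewrite eqEcard sKA cK.
  rewrite j0 leqn0 cards_eq0; apply/eqP/setP => u; rewrite !inE KA.
  apply/negP => /andP[uA].
  rewrite /deg (_ : [set _ | _] = A :\ u).
    move: (cardsD1 u A); rewrite uA -[in X in X = _]KA cK add1n addn0 => -[<-].
    by rewrite ltnn.
  by apply/setP => v; rewrite !inE /complete_on uA /= andbC eq_sym.
move=> A e K x y tA IH sKA cK clK yK xA K' j sK' cK' cl.
rewrite cardsU1 xA /= add1n ltnS => lt.
have Kk1 := subset_leq_card sKA; rewrite cK in Kk1.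
have old := deg_add_old K y tA xA.
have degS u : u \in A -> deg e u <= deg (add_vertex e x (K :\ y)) u.
  by move=> uA; rewrite (old _ uA) leq_addr.
have [xK'|xK'] := boolP (x \in K').
  have sQ := clique_add_new tA sKA xA xK' cl.
  have sub i : [set u in K' :\ x | deg e u < k + i] \subset
               [set u in K | deg e u < k + i].
    by apply/subsetP => u; rewrite !inE => /andP[/andP[ux uK'] ->];
       have := subsetP sQ u; rewrite !inE ux uK' => /(_ isT)/andP[_ ->].
  have sA u : u \in K' -> u != x -> u \in A.
    by move=> uK' ux; have := subsetP sK' u uK'; rewrite !inE (negPf ux).
  case: j lt => [|j] lt.
    rewrite -[X in _ <= X](_ : #|[set u in K | deg e u < k + 0]| = 0); last first.
      by apply/eqP; rewrite -leqn0 IH //; lia.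
    apply: leq_trans (subset_leq_card (sub 0)).
    apply/subset_leq_card/subsetP => u; rewrite !inE addn0 => /andP[uK' du].
    have ux : u != x.
      by apply: contraTneq du => ->; rewrite (deg_add_new tA) // ltnn.
    by rewrite ux uK' (leq_ltn_trans _ du) // degS ?sA.
  (* Every other vertex of [K'] lies in [K :\ y] and gains the edge to [x], so the threshold drops
     by one in the old graph; [x] itself accounts for the extra unit. *)
  have {IH} := IH K j sKA cK clK; rewrite (_ : j + k < _); last by lia.
  move=> /(_ isT) IH.
  apply: (@leq_trans #|x |: [set u in K | deg e u < k + j]|); last first.
    by rewrite cardsU1; case: (_ \notin _) => /=; lia.
  apply/subset_leq_card/subsetP => u; rewrite !inE => /andP[uK' du].
  have [//|ux /=] := eqVneq u x.
  have uQ : u \in K :\ y by apply: (subsetP sQ); rewrite !inE ux.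
  move: du; rewrite old ?sA // uQ addn1 addnS ltnS => ->.
  by move: uQ; rewrite !inE => /andP[_ ->].
have s := add_subset_old sK' xK'.
have {}cl : clique e K' by apply/(clique_add_old K e y xA s).
have [lt2|ge] := ltnP (j + k) #|A|.
  apply: leq_trans (IH _ _ s cK' cl lt2).
  apply/subset_leq_card/subsetP => u; rewrite !inE => /andP[uK' du].
  by rewrite uK' (leq_ltn_trans _ du) // degS // (subsetP s).
have eA : #|A| = j + k by lia.
case: j lt ge eA => [|j] lt ge eA; first by lia.
have {}IH := IH K' j s cK' cl; rewrite eA addSn ltnS leqnn in IH.
move/(_ isT): IH => IH.
(* Now [#|A| = k + j + 1]. A vertex [u != y] of [K'] with old degree at least [k + j] is adjacent to
   all the rest of [A]: inside [K] it gains the edge to [x], outside [K] it extends [K] to a clique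
   on [k + 2] vertices. *)
apply: (@leq_trans #|y |: [set u in K' | deg e u < k + j]|); last first.
  by rewrite cardsU1; case: (_ \notin _) => /=; lia.
apply/subset_leq_card/subsetP => u; rewrite !inE => /andP[uK' du].
have [//|uy /=] := eqVneq u y; rewrite uK' /= ltnNge; apply/negP => ge'.
have uA := subsetP s u uK'.
have [uK|uK] := boolP (u \in K).
  by move: du; rewrite old // !inE uy uK /=; lia.
have univ : [set v | e u v] = A :\ u.
  apply/eqP; rewrite eqEcard; apply/andP; split.
    apply/subsetP => v; rewrite !inE.
    by case/(ktree_sub tA)/and3P => _ -> nuv; rewrite eq_sym nuv.
  by move: ge'; rewrite /deg; move: (cardsD1 u A); rewrite uA; lia.
have adju v : v \in K -> e u v.
  move=> vK; suff : v \in [set v | e u v] by rewrite inE.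
  rewrite univ !inE (subsetP sKA) // andbT; apply: contraNneq uK => <- //.
suff : #|u |: K| <= k.+1 by rewrite cardsU1 uK cK; lia.
apply: (ktree_clique tA); first by rewrite subUset sub1set uA.
move=> a b /setU1P[->|aK] /setU1P[->|bK] ab.
- by rewrite eqxx in ab.
- exact: adju.
- exact/(ktree_sym tA)/adju.
- exact: clK.
Qed.

Definition deficiency A e d := \sum_(u in A) (k + d - deg e u).

(** The new vertex has degree [k] and contributes [d]. An old vertex loses 1 only if it lies in
    [K :\ y] and its deficiency was still positive. *)
Lemma deficiency_add A K e x y d : ktree A e -> K \subset A -> #|K| = k.+1 ->
  clique e K -> y \in K -> x \notin A ->
  deficiency A e d + d <= deficiency (x |: A) (add_vertex e x (K :\ y)) d
     + #|[set u in K :\ y | deg e u < k + d]|.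
Proof.
move=> tA sKA cK clK yK xA.
rewrite /deficiency big_setU1 //= (deg_add_new tA) //.
suff : \sum_(u in A) (k + d - deg e u) <=
       \sum_(u in A) (k + d - deg (add_vertex e x (K :\ y)) u) +
       #|[set u in K :\ y | deg e u < k + d]| by lia.
rewrite -sum1_card big_mkcond [X in _ <= _ + X]big_mkcond /=.
rewrite [X in _ <= X + _]big_mkcond /= -big_split /=.
apply: leq_sum => u _; case: ifP => // uA.
rewrite (deg_add_old K y tA xA) // [u \in [set _ in _ | _]]inE.
by case: (u \in K :\ y) => //=; try case: ifP; lia.
Qed.

(* An equality as long as no degree exceeds [k + d]. *)
Lemma deficiency_lower A e d : ktree A e -> k < #|A| ->
  #|A| * d <= deficiency A e d + k * (#|A| - k.+1).
Proof.
elim=> {A e} [A cA|A e K x y tA IH sKA cK clK yK xA] lt.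
  apply: (@leq_trans (deficiency A (complete_on A) d)); last by lia.
  rewrite /deficiency -sum_nat_const; apply: leq_sum => u uA.
  have := ktree_deg_le u (ktree_complete cA).
  by move: (cardsD1 u A); rewrite uA; lia.
have Kk1 := subset_leq_card sKA; rewrite cK in Kk1.
have := deficiency_add d tA sKA cK clK yK xA.
have : #|[set u in K :\ y | deg e u < k + d]| <= k.
  have -> : k = #|K :\ y| by move: (cardsD1 y K); rewrite yK cK => -[].
  by apply/subset_leq_card/subsetP => u; rewrite inE => /andP[].
have := IH Kk1; rewrite cardsU1 xA add1n mulSn.
rewrite subSn // mulnS; lia.
Qed.

Lemma ktree_deficiency A e d : ktree A e -> k + d < #|A| ->
  d * d.+1 <= deficiency A e d.
Proof.
move=> tA lt.
(* On [k + d + 1] vertices the lower bound reads [(k + d + 1) d - k d = d (d + 1)]. *)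
have base : forall B f, ktree B f -> #|B| = k + d.+1 -> d * d.+1 <= deficiency B f d.
  move=> B f tB cB; have kB : k < #|B| by lia.
  have := deficiency_lower d tB kB; rewrite cB.
  by have -> : k + d.+1 - k.+1 = d; [lia | nia].
elim: tA lt => {A e} [A cA lt|A e K x y tA IH sKA cK clK yK xA lt].
  by apply: base; [exact: ktree_complete | lia].
have [eA|nA] := eqVneq #|x |: A| (k + d.+1).
  by apply: base eA; apply: ktree_add.
move: lt nA; rewrite cardsU1 xA add1n => lt nA.
have := deficiency_add d tA sKA cK clK yK xA.
have ltA : d + k < #|A| by lia.
have := ktree_few_low_degree tA sKA cK clK ltA.
have : #|[set u in K :\ y | deg e u < k + d]| <= #|[set u in K | deg e u < k + d]|.
  by apply/subset_leq_card/subsetP => u; rewrite !inE => /andP[/andP[_ ->] ->].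
have ltA' : k + d < #|A| by lia.
have := IH ltA'; lia.
Qed.

End KTree.

(** * From tree decompositions to k-trees *)

Section PartialKTree.
Variables (V : finType) (k : nat).
Implicit Types (A K Q S X : {set V}) (e : rel V).

(* While [A] has at most [k.+1] vertices it is itself the only maximal clique,
   hence the minimum. *)
Definition in_bag A e S := exists K : {set V},
  [/\ S \subset K, K \subset A, clique e K & #|K| = minn k.+1 #|A|].

(** Once [#|A| > k], the set [S] misses some [y] of its clique [K], and exchanging [y] for [x]
    yields a clique containing [x |: S]. For smaller [A] the complete graph on [x |: A] serves. *)
Lemma ktree_add_bag A e S x :
  ktree k A e -> in_bag A e S -> #|S| <= k -> x \notin A ->
  exists e', [/\ ktree k (x |: A) e',
    forall S', in_bag A e S' -> in_bag (x |: A) e' S'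
    & in_bag (x |: A) e' (x |: S)].
Proof.
move=> tA bS cS xA.
have cA' : #|x |: A| = #|A|.+1 by rewrite cardsU1 xA.
have [small|large] := leqP #|A| k.
  exists (complete_on (x |: A)).
  have bag S' : S' \subset x |: A -> in_bag (x |: A) (complete_on (x |: A)) S'.
    move=> sS'; exists (x |: A); split=> //; last by rewrite cA'; lia.
    by move=> a b aA bA ab; rewrite /complete_on aA bA.
  split; first by apply: ktree_complete; rewrite cA'; lia.
    move=> S' [K [sSK sKA _ _]]; apply: bag.
    exact: subset_trans sSK (subset_trans sKA (subsetUr _ _)).
  have [K [sSK sKA _ _]] := bS.
  by apply/bag/setUS/(subset_trans sSK).
have [K [sSK sKA clK cK]] := bS.
have {}cK : #|K| = k.+1 by rewrite cK; lia.
have /subsetPn[y yK yS] : ~~ (K \subset S).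
  by apply/negP => /subset_leq_card; rewrite cK; lia.
have xK : x \notin K by apply: contra xA => /(subsetP sKA).
exists (add_vertex e x (K :\ y)); split.
- exact: ktree_add.
- move=> S' [K' [sSK' sKA' clK' cK']]; exists K'; split=> //.
  + exact: subset_trans sKA' (subsetUr _ _).
  + by move=> a b aK bK ab; rewrite /add_vertex clK'.
  + by rewrite cK' cA'; lia.
- exists (x |: (K :\ y)); split.
  + apply: setUS; apply/subsetP => z zS; rewrite !inE (subsetP sSK) // andbT.
    by apply: contraNneq yS => <-.
  + by apply: setUS; apply: subset_trans (subsetDl _ _) sKA.
  + move=> a b /setU1P[->|aQ] /setU1P[->|bQ] ab; rewrite /add_vertex.
    * by rewrite eqxx in ab.
    * by rewrite eqxx bQ !orbT.
    * by rewrite eqxx aQ !orbT.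
    * by case/setD1P: aQ => _ aK; case/setD1P: bQ => _ bK; rewrite clK.
  + rewrite cardsU1 !inE (negPf xK) andbF cA' /=.
    by move: (cardsD1 y K); rewrite yK cK /=; lia.
Qed.

Lemma ktree_add_bags A e S X :
  ktree k A e -> in_bag A e S -> #|S :|: X| <= k.+1 -> [disjoint X & A] ->
  exists e', [/\ ktree k (X :|: A) e',
    forall S', in_bag A e S' -> in_bag (X :|: A) e' S'
    & in_bag (X :|: A) e' (X :|: S)].
Proof.
move: {2}#|X| (leqnn #|X|) => n; elim: n X => [|n IH] X leX tA bS cSX dXA.
  have -> : X = set0 by apply/eqP; rewrite -cards_eq0 -leqn0.
  by exists e; rewrite !set0U.
have [->|[x xX]] := set_0Vmem X; first by exists e; rewrite !set0U.
have cX := cardsD1 x X; rewrite xX in cX.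
have xA : x \notin A by rewrite (disjointFr dXA).
have [K0 [sSK0 sKA0 _ _]] := bS.
have xS : x \notin S by apply: contra xA => /(subsetP sSK0)/(subsetP sKA0).
have XS : X :\ x :|: S = (S :|: X) :\ x.
  by rewrite setUC setDUl; congr (_ :|: _); apply/setP => z; rewrite !inE;
     case: eqP => // ->; rewrite (negPf xS).
(* As [x] is added last, the bag it joins has at most [k] vertices. *)
have cSX' : #|(S :|: X) :\ x| <= k.
  by move: (cardsD1 x (S :|: X)); rewrite !inE xX orbT; lia.
have [|//|//|||e1 [t1 b1 bS1]] := IH (X :\ x).
- by lia.
- by rewrite setUC XS; lia.
- exact: disjointWl (subsetDl _ _) dXA.
have xXA : x \notin X :\ x :|: A by rewrite !inE eqxx.
have [|e2 [t2 b2 bS2]] := ktree_add_bag t1 bS1 _ xXA; first by rewrite XS.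
have E (B : {set V}) : x |: (X :\ x :|: B) = X :|: B by rewrite setUA setD1K.
rewrite !E in t2 b2 bS2.
by exists e2; split=> // S' /b1/b2.
Qed.

End PartialKTree.

(** * Growing a k-tree along the decomposition tree *)

Section TreeDecomposition.
Variables (k : nat) (G T : sgraph) (B : T -> {set G}) (U : {set G}).
Hypotheses (dB : is_tree_decomposition B) (cB : forall t, #|B t| <= k.+1).

Let part (P : {set T}) := \bigcup_(t in P) (B t :&: U).
Let within (P : {set T}) : rel T := fun s t => [&& s \in P, t \in P & adj s t].

Lemma within_path (P : {set T}) s p :
  s \in P -> path (within P) s p -> path (@adj T) s p && all (mem P) (s :: p).
Proof.
elim: p s => [|t p IH] s sP /=; first by rewrite sP.
by case/andP => /and3P[_ tP ->] /(IH t tP) /= /and3P[-> -> ->]; rewrite sP.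
Qed.

(** The invariant of the construction: [P] is a connected piece of the tree, and the vertices of [U]
    met so far carry a [k]-tree in which the trace of each bag lies in a clique of full size. *)
Let processed (P : {set T}) :=
  [/\ P != set0, {in P &, forall s t, connect (within P) s t} &
    exists2 e, ktree k (part P) e &
      forall t, t \in P -> in_bag k (part P) e (B t :&: U)].

Lemma processed1 t : processed [set t].
Proof.
have partE : part [set t] = B t :&: U by rewrite /part big_set1.
split.
- by apply/set0Pn; exists t; rewrite inE.
- by move=> s r /set1P-> /set1P->; apply: connect0.
- have le : #|B t :&: U| <= k.+1.
    exact: leq_trans (subset_leq_card (subsetIl _ _)) (cB t).
  rewrite partE; exists (complete_on (B t :&: U)); first exact: ktree_complete.
  move=> s /set1P->; exists (B t :&: U); split=> //; last by lia.
  by move=> a b aB bB ab; rewrite /complete_on aB bB.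
Qed.

Lemma processed_add (P : {set T}) s t :
  processed P -> t \in P -> s \notin P -> adj t s -> processed (s |: P).
Proof.
move=> [nP conP [e tP bP]] tIn sNin ts.
have mono : subrel (connect (within P)) (connect (within (s |: P))).
  apply: connect_sub => a b /and3P[aP bP' ab]; apply: connect1.
  by rewrite /within !inE aP bP' !orbT.
have st1 : connect (within (s |: P)) s t.
  by apply: connect1; rewrite /within !inE eqxx tIn orbT adj_sym.
have ts1 : connect (within (s |: P)) t s.
  by apply: connect1; rewrite /within !inE eqxx tIn orbT.
split.
- by apply/set0Pn; exists s; rewrite !inE eqxx.
- move=> a b /setU1P[->|aP] /setU1P[->|bP'].
  + exact: connect0.
  + exact: connect_trans st1 (mono _ _ (conP _ _ tIn bP')).
  + exact: connect_trans (mono _ _ (conP _ _ aP tIn)) ts1.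
  + exact/mono/conP.
(* A simple path inside [P] from [t] to a bag containing [v] stays simple when [s] is put in front.
   So the new bag meets the old part only within [B t]. *)
have sub v : v \in B s -> v \in part P -> v \in B t.
  move=> vs /bigcupP[r rP /setIP[vr _]].
  have /connectP[p0 p0P rE] := conP _ _ tIn rP.
  move: vr; rewrite rE; case: (shortenP p0P) => p pP up _ vr.
  have [_ _ _ sp] := dB.
  have /andP[pP' /allP allP'] := within_path tIn pP.
  apply: (sp v s (last t p) t (t :: p)) => //.
  - by rewrite /= adj_sym ts.
  - by rewrite cons_uniq up andbT; apply: contra sNin => /allP'.
  - by rewrite !inE eqxx orbT.
pose X := (B s :&: U) :\: part P.
have partE : part (s |: P) = X :|: part P.
  rewrite /part bigcup_setU big_set1 -/(part P) /X.
  by apply/setP => v; rewrite !inE; case: (v \in part P); rewrite ?orbT ?orbF.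
pose S := B s :&: U :&: part P.
have bS : in_bag k (part P) e S.
  have [K [sK1 sK2 clK cK]] := bP _ tIn; exists K; split=> //.
  apply: subset_trans sK1; apply/subsetP => v; rewrite !inE.
  by case/andP => /andP[vs ->] vP; rewrite (sub v).
have SX : S :|: X = B s :&: U by rewrite /S /X setID.
have [||e' [t' b' bS']] := ktree_add_bags tP bS (X := X).
- by rewrite SX (leq_trans (subset_leq_card (subsetIl _ _)) (cB s)).
- by rewrite -setI_eq0; apply/eqP/setP => v; rewrite !inE; case: (v \in part P);
     rewrite ?andbF.
rewrite partE; exists e' => // r /setU1P[->|rP]; last exact/b'/bP.
by rewrite -SX (setUC S).
Qed.

Lemma tree_decomposition_ktree : exists2 e, ktree k U e &
  {in U &, forall u v, adj u v -> e u v}.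
Proof.
have [[cT conT _] cov covE _] := dB.
have [t0 _] : exists t0 : T, t0 \in T by apply/card_gt0P.
have ex : exists n : nat, `[< exists2 P : {set T}, processed P & #|P| = n >].
  by exists 1; apply/asboolP; exists [set t0]; rewrite ?cards1 //; apply: processed1.
have ub n : `[< exists2 P : {set T}, processed P & #|P| = n >] -> n <= #|T|.
  by move=> /asboolP[P _ <-]; apply: max_card.
case: (ex_maxnP ex ub) => n /asboolP[P procP cP] maxP.
have PT : P = [set: T].
  apply/eqP; rewrite -subTset; apply/negPn/negP => /subsetPn[s _ sP].
  have [/set0Pn[r rP] _ _] := procP.
  have /connectP[p pP pE] := conT r s.
  have [t [s' [tP s'P ts']]] : exists t s', [/\ t \in P, s' \notin P & adj t s'].
    elim: p r rP pP pE => [|q p IH] r rP /=; first by move=> _ E; rewrite E rP in sP.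
    case/andP => rq qp E; have [qP|qP] := boolP (q \in P); first exact: IH qP qp E.
    by exists r, q.
  have := maxP _ (introT (asboolP _) (ex_intro2 _ _ _
    (processed_add procP tP s'P ts') erefl)).
  by rewrite cardsU1 s'P cP ltnn.
have [_ _ [e tP bP]] := procP.
have partU : part P = U.
  apply/setP => v; apply/bigcupP/idP => [[t _ /setIP[]] //|vU].
  by have [t vt] := cov v; exists t; rewrite ?PT // inE vt.
rewrite partU in tP bP; exists e => // u v uU vU uv.
have [t [ut vt]] := covE u v uv.
have [|K [sK _ clK _]] := bP t; first by rewrite PT.
apply: clK; rewrite ?(subsetP sK) ?inE ?ut ?vt //.
by apply: contraTneq uv => ->; rewrite adj_irrefl.
Qed.

End TreeDecomposition.

(** * Edge density of induced subgraphs *)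

Section Density.
Variables (G : sgraph) (k d : nat).
Hypotheses (decG : has_tree_decomposition_of_width G k) (kd : k <= d ^ 2).
Hypothesis degG : forall v : G, degree v <= k + d.

(** The sum counts each edge of [G[U]] twice, which absorbs the factor 1/2. *)
Lemma treewidth_density (U : {set G}) : U != set0 ->
  \sum_(u in U) #|[set v in U | adj u v]| <= (k + d) * #|U|.-1.
Proof.
move=> U0; have cU : 0 < #|U| by rewrite card_gt0.
have [le|gt] := leqP #|U| (k + d).
  apply: (@leq_trans (\sum_(u in U) #|U|.-1)).
    apply: leq_sum => u uU; rewrite -ltnS prednK //.
    apply: proper_card; apply/properP; split.
      by apply/subsetP => v; rewrite inE => /andP[].
    by exists u; rewrite // inE adj_irrefl andbF.
  by rewrite sum_nat_const leq_mul2r le orbT.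
have [T [B [dB cB]]] := decG.
have [e tU eU] := tree_decomposition_ktree U dB cB.
have := ktree_deficiency tU gt.
(* Termwise. The bound by the degree in [G] covers the vertices whose deficiency is truncated to
   0. *)
have : deficiency k U e d + \sum_(u in U) #|[set v in U | adj u v]| <=
       #|U| * (k + d).
  rewrite /deficiency -big_split -sum_nat_const /=; apply: leq_sum => u uU.
  have : #|[set v in U | adj u v]| <= deg e u.
    apply/subset_leq_card/subsetP => v; rewrite !inE => /andP[vU uv].
    exact: eU.
  have : #|[set v in U | adj u v]| <= degree u.
    by apply/subset_leq_card/subsetP => v; rewrite !inE => /andP[].
  have := degG u; lia.
(* The deficiency [d (d + 1)] is at least [k + d], the gap between [(k + d) #|U|] and
   [(k + d) (#|U| - 1)]. *)
case: #|U| cU => // n _ /=; move: kd; rewrite -mulnn; nia.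
Qed.

End Density.

(** * Maximum weight matchings *)

Section DihedralOrbit.
Variables (V : finType) (m n : V -> V) (t : V).
Hypotheses (mK : involutive m) (nK : involutive n) (nt : n t = t).
Let f v := m (n v).

Let f_inj : injective f.
Proof. exact: inj_comp (can_inj mK) (can_inj nK). Qed.

(** Thus [n] sends [f^i t] to [f^(-i) t]: the orbit of [t] under [f] is closed under [n], and so
    under [m], which is [f] after [n]. *)
Let iter_n i : iter i f (n (iter i f t)) = t.
Proof. by elim: i => //= i IH; rewrite -iterS iterSr /f nK mK. Qed.

Let fixed_iter i : m (iter i f t) = iter i f t -> iter (i + i) f t = f t.
Proof.
move=> fx; rewrite iterD.
have fn : f (n (iter i f t)) = iter i f t by rewrite /f nK.
by rewrite -[X in iter i f X]fn -iterSr /= iter_n.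
Qed.

(** The period of [t] divides [2 a] and the odd number [2 i - 1], hence it divides [a]. *)
Let iter_period a i : iter (a + a) f t = t -> iter (i + i) f t = f t ->
  iter a f t = t.
Proof.
move=> pa hi.
have -> : iter a f t = iter (a * (i + i)) f t.
  elim: a {pa} => // a IH.
  by rewrite iterSr -hi -iterD addnC iterD IH -iterD -mulSn.
rewrite mulnDr -mulnDl mulnC; elim: i {hi} => // i IH.
by rewrite mulSn iterD IH.
Qed.

(* In the symmetric difference of two matchings, the component of a vertex
   missed by the second one is a path, with at most one other endpoint. *)
Lemma dihedral_orbit : exists C : {set V}, [/\ t \in C,
    forall x, x \in C -> m x \in C /\ n x \in C,
    {in C &, forall x y, m x = x -> m y = y -> x = y} &
    forall P : pred V, P t -> (forall x, P x -> P (m x) /\ P (n x)) ->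
      forall x, x \in C -> P x].
Proof.
exists [set x | fconnect f t x].
have orb x : fconnect f t x -> exists i, x = iter i f t.
  by move/iter_findex => <-; eexists.
have closed_n x : fconnect f t x -> fconnect f t (n x).
  case/orb=> i ->; rewrite (fconnect_sym f_inj).
  by rewrite -[X in fconnect f _ X](iter_n i) fconnect_iter.
split.
- by rewrite inE connect0.
- move=> x; rewrite !inE => tx; split; last exact: closed_n.
  have -> : m x = f (n x) by rewrite /f nK.
  exact: connect_trans (closed_n _ tx) (fconnect1 _ _).
- move=> x y; rewrite !inE => /orb[i ->] /orb[j ->].
  wlog le : i j / i <= j => [H|].
    by case: (leqP i j) => [|/ltnW] /H h *; [|symmetry]; apply: h.
  move=> /fixed_iter fi /fixed_iter fj.
  have [a ja] : exists a, j = i + a by exists (j - i); rewrite subnKC.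
  have fa : iter (a + a) f t = t.
    apply: f_inj; rewrite -iterS iterSr -[in LHS]fi -iterD.
    by rewrite -fj ja; congr (iter _ f t); lia.
  by rewrite ja iterD (iter_period fa fi).
- move=> P Pt PC x; rewrite inE => /orb[i ->].
  by elim: i => //= i IH; apply PC; apply PC.
Qed.

End DihedralOrbit.

Section WeightedMatching.
Variable V : finType.
Implicit Types (W : V -> V -> nat) (s : {ffun V -> V}) (U : {set V}).

(** A matching is an involution whose fixed points are the uncovered vertices; its edges lie in the
    support of [W]. *)
Definition is_matching W s :=
  [forall v, (s (s v) == v) && ((s v != v) ==> (0 < W v (s v)))].

Lemma is_matchingP W s : reflect
  (involutive s /\ forall v, s v != v -> 0 < W v (s v)) (is_matching W s).
Proof.
apply: (iffP forallP) => [H|[sK sW] v]; last first.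
  by rewrite sK eqxx; apply/implyP/sW.
split=> v; have /andP[/eqP sK /implyP] := H v => //.
Qed.

(** Here and in [weight] each edge is counted from both ends, so both are twice the usual
    weights. *)
Definition total_weight W := \sum_u \sum_v W u v.
Definition weight W s := \sum_v W v (s v).

Definition symmetric_weight W :=
  (forall u v, W u v = W v u) /\ forall v, W v v = 0.

(** The two ends of a matching edge contribute equally; comparing ranks separates the two halves. *)
Lemma weight_even W s :
  symmetric_weight W -> is_matching W s -> ~~ odd (weight W s).
Proof.
move=> [symW irrW] /is_matchingP[sK _].
pose r (v : V) : nat := enum_rank v.
have rlt v : W v (s v) = (if r v < r (s v) then W v (s v) else 0) +
                         (if r (s v) < r v then W v (s v) else 0).
  case: (ltngtP (r v) (r (s v))) => //; first by rewrite addn0.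
  by move/val_inj/enum_rank_inj => <-; rewrite irrW.
rewrite /weight (eq_bigr _ (fun v _ => rlt v)) big_split /=.
rewrite [X in _ + X](reindex_inj (can_inj sK)) /=.
set a := (X in X + _); set b := (X in _ + X).
suff -> : b = a by rewrite addnn odd_double.
by apply: eq_bigr => v _; rewrite sK symW.
Qed.

(** Subtraction truncates: positive entries in [g] drop by 1, zero entries stay 0. *)
Definition lower W (g : rel V) u v := W u v - g u v.

Lemma lowerE W (g : rel V) u v :
  W u v = lower W g u v + (g u v && (0 < W u v)).
Proof. by rewrite /lower; case: (g u v) => /=; lia. Qed.

Lemma total_lower W g :
  total_weight W = total_weight (lower W g) + \sum_u #|[set v | g u v & 0 < W u v]|.
Proof.
rewrite /total_weight -big_split; apply: eq_bigr => u _ /=.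
rewrite (eq_bigr _ (fun v _ => lowerE W g u v)) big_split /=; congr (_ + _).
by rewrite -sum1dep_card [RHS]big_mkcond; apply: eq_bigr => v _; case: ifP.
Qed.

Lemma weight_lower W g s : weight W s = weight (lower W g) s +
  #|[set v | g v (s v) & 0 < W v (s v)]|.
Proof.
rewrite /weight (eq_bigr _ (fun v _ => lowerE W g v (s v))) big_split /=.
congr (_ + _).
by rewrite -sum1dep_card [RHS]big_mkcond; apply: eq_bigr => v _; case: ifP.
Qed.

Lemma lower_symmetric W (g : rel V) :
  symmetric_weight W -> symmetric g -> symmetric_weight (lower W g).
Proof.
move=> [symW irrW] symg; split=> [u v|v]; last by rewrite /lower irrW.
by rewrite /lower symW symg.
Qed.

Lemma is_matching_lower W g s : is_matching (lower W g) s -> is_matching W s.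
Proof.
move=> /is_matchingP[sK sW]; apply/is_matchingP; split=> // v /sW.
by rewrite /lower; lia.
Qed.

Section Component.
Variables (W : V -> V -> nat) (U : {set V}).
Hypothesis symW : symmetric_weight W.
Hypothesis closedU : forall u v, 0 < W u v -> (u \in U) = (v \in U).
Let inU : rel V := fun u v => (u \in U) && (v \in U).
Let W' := lower W inU.
Definition covered s := #|[set v in U | s v != v]|.

Lemma covered_fixed s : covered s + #|[set v in U | s v == v]| = #|U|.
Proof.
rewrite addnC -(cardsID [set v | s v == v] U); congr (_ + _).
  by apply: eq_card => v; rewrite !inE.
by apply: eq_card => v; rewrite !inE andbC.
Qed.

Lemma weight_lower_in s :
  is_matching W s -> weight W s = weight W' s + covered s.
Proof.
move=> /is_matchingP[sK sW]; rewrite (weight_lower W inU); congr (_ + _).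
apply: eq_card => v; rewrite !inE /inU.
have [->|/sW lt] := eqVneq (s v) v; first by rewrite (symW.2 v) !andbF.
by rewrite lt (closedU lt) andbb.
Qed.

(** Lexicographic choice: largest [W']-weight first, then most covered vertices of [U]. Edges need
    only positive [W], so those with [W'] equal to 0 may still serve to cover vertices. *)
Let optimal s := is_matching W s /\ forall r, is_matching W r ->
  weight W' r <= weight W' s /\
  (weight W' r = weight W' s -> covered r <= covered s).

Lemma optimal_exists : exists s, optimal s.
Proof.
pose s0 : {ffun V -> V} := [ffun v => v].
have m0 : is_matching W s0.
  by apply/is_matchingP; split=> v; rewrite !ffunE ?eqxx.
case: (arg_maxnP (weight W') m0) => s1 m1 max1.
pose P s := is_matching W s && (weight W' s == weight W' s1).
have P1 : P s1 by rewrite /P m1 eqxx.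
case: (arg_maxnP covered P1) => s2 /andP[m2 /eqP w2] max2.
exists s2; split=> // r mr; rewrite w2; split; first exact: max1.
by move=> wr; apply: max2; rewrite /P mr wr eqxx.
Qed.

(** Adding the edge [uv] would not lower the [W']-weight and would cover more of [U]. *)
Lemma optimal_adjacent s u v : optimal s -> u \in U -> 0 < W u v ->
  s u = u -> s v = v -> False.
Proof.
move=> [ms opt] uU lt su sv.
have [sK sW] := is_matchingP _ _ ms.
have uv : u != v by apply: contraTneq lt => ->; rewrite symW.2.
have vu : (v == u) = false by rewrite eq_sym (negPf uv).
pose s1 : {ffun V -> V} :=
  [ffun x => if x == u then v else if x == v then u else s x].
have neq x y : x != y -> s y = y -> (s x == y) = false.
  move=> xy sy; apply: contraNF xy => /eqP sx.
  by rewrite -(sK x) sx sy.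
have m1 : is_matching W s1.
  apply/is_matchingP; split=> x; rewrite !ffunE.
    have [->|xu] := eqVneq x u; first by rewrite vu eqxx.
    have [->|xv] := eqVneq x v; first by rewrite eqxx.
    by rewrite !neq.
  have [->|xu] := eqVneq x u; first by [].
  have [->|xv] := eqVneq x v; last exact: sW.
  by rewrite symW.1.
have le1 : weight W' s <= weight W' s1.
  apply: leq_sum => x _; rewrite ffunE.
  have [->|xu] := eqVneq x u; first by rewrite su /W' /lower symW.2.
  by have [->|xv] := eqVneq x v; first by rewrite sv /W' /lower symW.2.
have ltc : covered s < covered s1.
  apply: proper_card; apply/properP; split.
    apply/subsetP => x; rewrite !inE ffunE => /andP[-> /=].
    have [->|xu] := eqVneq x u; first by rewrite su eqxx.
    by have [->|xv] := eqVneq x v; first by rewrite sv eqxx.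
  exists u; first by rewrite inE uU ffunE eqxx eq_sym.
  by rewrite inE su eqxx andbF.
have [ge1 opt1] := opt _ m1.
have := opt1 _; lia.
Qed.

(* Exchanging an optimal [s] with a maximum weight matching [r] missing [t]
   along the component of [t] keeps [s] optimal and uncovers [t]. *)
Lemma optimal_swap s r t u v : optimal s -> is_matching W r ->
  (forall r', is_matching W r' -> weight W r' <= weight W r) ->
  r t = t -> t \in U -> s u = u -> s v = v -> u != v ->
  exists2 s', optimal s' & s' t = t /\ (s' u = u \/ s' v = v).
Proof.
move=> [ms opt] mr maxr rt tU su sv uv.
have [sK sW] := is_matchingP _ _ ms; have [rK rW] := is_matchingP _ _ mr.
have [C [tC closedC fixC minC]] := dihedral_orbit sK rK rt.
have memC q x : (q = s \/ q = r) -> (q x \in C) = (x \in C).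
  move=> sr; have qK : involutive q by case: sr => ->.
  have cl y : y \in C -> q y \in C by move=> /closedC[] *; case: sr => ->.
  by apply/idP/idP => [/cl|/cl //]; rewrite qK.
have sC x : (s x \in C) = (x \in C) by apply: memC; left.
have rC x : (r x \in C) = (x \in C) by apply: memC; right.
have CU x : x \in C -> x \in U.
  apply: (minC (fun x => x \in U)) => // y yU; split.
    by have [->|/sW/closedU <-] := eqVneq (s y) y.
  by have [->|/rW/closedU <-] := eqVneq (r y) y.
pose s1 : {ffun V -> V} := [ffun x => if x \in C then r x else s x].
pose r1 : {ffun V -> V} := [ffun x => if x \in C then s x else r x].
have m1 : is_matching W s1.
  apply/is_matchingP; split=> x; rewrite !ffunE; case xC: (x \in C).
  - by rewrite rC xC rK.
  - by rewrite sC xC sK.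
  - exact: rW.
  - exact: sW.
have m2 : is_matching W r1.
  apply/is_matchingP; split=> x; rewrite !ffunE; case xC: (x \in C).
  - by rewrite sC xC sK.
  - by rewrite rC xC rK.
  - exact: sW.
  - exact: rW.
have sumE : weight W s1 + weight W r1 = weight W s + weight W r.
  rewrite /weight -!big_split; apply: eq_bigr => x _; rewrite !ffunE /=.
  by case: ifP => // _; rewrite addnC.
have s1t : s1 t = t by rewrite ffunE tC rt.
(* Outside [C] the two agree; inside, [s] misses at most one vertex while [s1] misses [t]. *)
have cov1 : covered s1 <= covered s.
  have le : #|[set x in U | s x == x]| <=
            #|[set x in U | s1 x == x] :\ t :|: [set x in C | s x == x]|.
    apply/subset_leq_card/subsetP => x; rewrite !inE ffunE => /andP[xU sx].
    rewrite sx andbT; have [xC|xC] := boolP (x \in C); first by rewrite orbT.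
    rewrite xU sx ?andbT ?orbF /=. by apply: contraNneq xC => ->.
  have le1 : #|[set x in C | s x == x]| <= 1.
    apply/card_le1_eqP => x y; rewrite !inE => /andP[xC /eqP sx] /andP[yC /eqP sy].
    exact: fixC.
  have [+ _] := leq_card_setU ([set x in U | s1 x == x] :\ t) [set x in C | s x == x].
  have := covered_fixed s; have := covered_fixed s1.
  have := cardsD1 t [set x in U | s1 x == x].
  rewrite [in X in X -> _]inE tU s1t eqxx /=; lia.
(* Maximality of [r] and [sumE] give [weight W s <= weight W s1]. Since neither [weight W'] nor
   [covered] grows from [s] to [s1], both are unchanged. *)
have E1 := weight_lower_in m1; have E := weight_lower_in ms.
have max2 := maxr _ m2.
have [le1 _] := opt _ m1.
exists s1.
  split=> // q mq; have [leq1 leq2] := opt _ mq.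
  split; first by lia.
  by move=> wq; have := leq2; have -> : weight W' q = weight W' s; lia.
split=> //; rewrite !ffunE.
case: (boolP (u \in C)) => uC; last by left.
case: (boolP (v \in C)) => vC; last by right.
by case/eqP: uv; apply: fixC.
Qed.

Hypothesis connU : {in U &, forall u v, connect (fun a b => 0 < W a b) u v}.
Hypothesis missU : forall t, t \in U -> exists r, [/\ is_matching W r,
  forall r', is_matching W r' -> weight W r' <= weight W r & r t = t].

(** Suppose [u] and [v] are both missed, and let [t] follow [u] on a path to [v]. Swapping frees [t]
    and keeps [u] or [v] missed: with [u] this contradicts [optimal_adjacent], with [v] the path has
    become shorter. *)
Lemma optimal_covered s : optimal s -> #|U|.-1 <= covered s.
Proof.
move=> opts; have := covered_fixed s.
suff : #|[set v in U | s v == v]| <= 1 by lia.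
apply/card_le1_eqP => u v; rewrite !inE.
case/andP => uU /eqP su /andP[vU /eqP sv]; apply/eqP/negPn/negP => vu.
have {vu} uv : u != v by rewrite eq_sym.
have /connectP[p pP vE] := connU uU vU.
elim: p s u opts uU su sv uv pP vE => [|t p IH] s u opts uU su sv uv /=.
  by move=> _ E; rewrite E eqxx in uv.
case/andP => ut tp vE; have tU : t \in U by rewrite -(closedU ut).
have [st|st] := eqVneq (s t) t; first exact: optimal_adjacent opts uU ut su st.
have [r [mr maxr rt]] := missU tU.
have [s' opts' [s't [s'u|s'v]]] := optimal_swap opts mr maxr rt tU su sv uv.
  exact: optimal_adjacent opts' uU ut s'u s't.
apply: IH opts' tU s't s'v _ tp vE.
by apply: contraNneq st => ->; rewrite sv.
Qed.

Lemma near_perfect_matching s' : is_matching W' s' ->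
  exists2 s, is_matching W s & weight W' s' + #|U|.-1 <= weight W s.
Proof.
move=> /is_matching_lower ms'; have [s opts] := optimal_exists.
have := optimal_covered opts; case: (opts) => ms opt.
exists s => //; have [le _] := opt _ ms'.
by rewrite (weight_lower_in ms); lia.
Qed.

End Component.

(* Schrijver's proof of the Edmonds and Cunningham-Marsh theorem, run with the
   constant fractional matching 1/D instead of an optimal dual solution. *)
Theorem weighted_matching (E : rel V) (D : nat) W :
  (forall u, #|[set v | E u v]| <= D) ->
  (forall U, U != set0 -> \sum_(u in U) #|[set v in U | E u v]| <= D * #|U|.-1) ->
  symmetric_weight W -> (forall u v, 0 < W u v -> E u v) ->
  exists2 s, is_matching W s & total_weight W <= D * weight W s.
Proof.
move=> degE denE; have [n] := ubnP (total_weight W); elim: n W => // n IH W leW symW subE.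
have degW u : #|[set v | 0 < W u v]| <= D.
  apply: leq_trans (degE u); apply/subset_leq_card/subsetP => v; rewrite !inE.
  exact: subE.
pose s0 : {ffun V -> V} := [ffun v => v].
have m0 : is_matching W s0.
  by apply/is_matchingP; split=> v; rewrite !ffunE ?eqxx.
have [[u0 [v0 W0]]|W0] := pselect (exists u v, 0 < W u v); last first.
  exists s0 => //; rewrite /total_weight big1 // => u _; rewrite big1 // => v _.
  by apply/eqP; rewrite -leqn0 leqNgt; apply/negP => lt; apply: W0; exists u, v.
case: (arg_maxnP (weight W) m0) => r mr maxr0.
have maxr s : is_matching W s -> weight W s <= weight W r := maxr0 s.
have step (g : rel V) : symmetric g -> (exists u v, g u v /\ 0 < W u v) ->
    exists2 s, is_matching (lower W g) s &
      total_weight (lower W g) <= D * weight (lower W g) s.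
  move=> symg [u [v [guv Wuv]]]; apply: IH.
  - suff : 0 < \sum_u #|[set v | g u v & 0 < W u v]|.
      by move: leW; rewrite (total_lower W g); lia.
    rewrite (bigD1 u) //= addn_gt0 card_gt0; apply/orP; left.
    by apply/set0Pn; exists v; rewrite inE guv.
  - exact: lower_symmetric.
  - by move=> a b; rewrite /lower => lt; apply: subE; lia.
have symS := symW.1.
have [[v [[w Wvw] cov]]|ncov] := pselect (exists v, (exists w, 0 < W v w) /\
    forall s, is_matching W s -> weight W s = weight W r -> s v != v).
  pose g : rel V := fun a b => (a == v) || (b == v).
  have [||s ms les] := step g.
  - by move=> a b; rewrite /g orbC.
  - by exists v, w; rewrite /g eqxx.
  have tot : \sum_u #|[set b | g u b & 0 < W u b]| <= D + D.
    rewrite (bigD1 v) //=; apply: leq_add.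
      rewrite (eq_card (B := [set b | 0 < W v b])) // => b.
      by rewrite !inE /g eqxx.
    apply: leq_trans (degW v); rewrite -sum1_card [X in _ <= X]big_mkcond /=.
    rewrite big_mkcond /=; apply: leq_sum => a _; rewrite inE.
    case: (eqVneq a v) => // av /=; rewrite symS.
    rewrite (eq_card (B := [set b | (b == v) && (0 < W a v)])).
      case: (0 < W a v); last by rewrite (eq_card0 (A := _)) // => b; rewrite !inE andbF.
      by rewrite (eq_card1 (x := v)) // => b; rewrite !inE andbT.
    move=> b; rewrite !inE /g (negPf av) /=.
    by case: eqVneq => // ->.
  have mWs := is_matching_lower ms.
  rewrite (total_lower W g).
  (* A gain of 2 pays for the loss of [2 D]. If [s] misses [v], it is not maximum for [W] and parity
     puts [r] at least 2 above it; if [s] covers [v], both orientations of that edge regain 1. *)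
  have [sv|sv] := eqVneq (s v) v.
    have lt : weight W s < weight W r.
      rewrite ltn_neqAle maxr // andbT; apply/eqP => /(cov s mWs).
      by rewrite sv eqxx.
    have : weight W s + 2 <= weight W r.
      have := weight_even symW mWs; have := weight_even symW mr; lia.
    exists r => //; have := weight_lower W g s; nia.
  exists s => //; have := weight_lower W g s.
  suff : 1 < #|[set a | g a (s a) & 0 < W a (s a)]| by nia.
  have [sK sW] := is_matchingP _ _ mWs.
  have lt := sW _ sv.
  apply/card_gt1P; exists v, (s v); split; last by rewrite eq_sym.
    by rewrite inE /g eqxx.
  by rewrite inE /g sK eqxx orbT symS.
pose U := [set x | connect (fun a b => 0 < W a b) u0 x].
have symc : connect_sym (fun a b => 0 < W a b).
  by apply: sym_connect_sym => a b; rewrite symS.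
have closedU u v : 0 < W u v -> (u \in U) = (v \in U).
  move=> lt; rewrite !inE; apply/idP/idP => h; apply: connect_trans h _.
    exact: connect1.
  by rewrite symc; apply: connect1.
have u0U : u0 \in U by rewrite inE connect0.
have connU : {in U &, forall u v, connect (fun a b => 0 < W a b) u v}.
  by move=> u v; rewrite !inE => hu; apply: connect_trans; rewrite symc.
(* Otherwise [t], which lies on an edge of positive weight, would fall under the first case. *)
have missU t : t \in U -> exists r, [/\ is_matching W r,
    forall r', is_matching W r' -> weight W r' <= weight W r & r t = t].
  move=> tU; apply: contrapT => no; apply: ncov; exists t; split.
    have [->|tu] := eqVneq t u0; first by exists v0.
    move: tU; rewrite inE symc => /connectP[[|x p] /=].
      by move=> _ u0t; rewrite u0t eqxx in tu.
    by case/andP => Wtx _ _; exists x.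
  move=> s ms ws; apply/eqP => st; apply: no; exists s; split=> // r' mr'.
  by rewrite ws; apply: maxr.
have [||s' ms' les'] := step (fun a b => (a \in U) && (b \in U)).
- by move=> a b; rewrite andbC.
- by exists u0, v0; rewrite -(closedU _ _ W0) u0U.
have [s ms le] := near_perfect_matching symW closedU connU missU ms'.
exists s => //; rewrite (total_lower W (fun a b => (a \in U) && (b \in U))).
have U0 : U != set0 by apply/set0Pn; exists u0.
(* The total drops by at most [D (#|U| - 1)], while the matching gains at least [#|U| - 1]. *)
have := denE U U0.
have : \sum_u #|[set v | (u \in U) && (v \in U) & 0 < W u v]| <=
       \sum_(u in U) #|[set v in U | E u v]|.
  rewrite [X in _ <= X]big_mkcond /=; apply: leq_sum => u _.
  case: ifP => uU /=; last by rewrite eq_card0 // => b; rewrite !inE.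
  by apply/subset_leq_card/subsetP => b; rewrite !inE => /andP[-> /subE].
have : D * (weight (lower W (fun a b => (a \in U) && (b \in U))) s' + #|U|.-1)
    <= D * weight W s by rewrite leq_mul2l le orbT.
rewrite mulnDr; lia.
Qed.

End WeightedMatching.

(** * Farkas' lemma *)

Section Farkas.
Local Open Scope ring_scope.
Variables (F : realFieldType) (I : finType) (J : eqType).
Implicit Types (u v c : I -> F).

Definition dot u v := \sum_i u i * v i.

Lemma dotBr u v a w : dot u (fun i => v i - a * w i) = dot u v - a * dot u w.
Proof.
rewrite /dot mulr_sumr -sumrB; apply: eq_bigr => i _; ring.
Qed.

Lemma dotBl u v a w : dot (fun i => v i - a * w i) u = dot v u - a * dot w u.
Proof.
rewrite /dot mulr_sumr -sumrB; apply: eq_bigr => i _; ring.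
Qed.

Lemma dotZr u v a : dot u (fun i => a * v i) = a * dot u v.
Proof. by rewrite /dot mulr_sumr; apply: eq_bigr => i _; ring. Qed.

(* Bartl's induction: a direction [x] violating the statement for the tail is
   used to project both the tail and [gamma] along the head. *)
Lemma farkas (s : seq J) (alpha : J -> I -> F) (gamma : I -> F) : uniq s ->
  (forall c, (forall j, j \in s -> dot (alpha j) c <= 0) -> dot gamma c <= 0) ->
  exists2 lam : J -> F, forall j, 0 <= lam j &
    forall i, gamma i = \sum_(j <- s) lam j * alpha j i.
Proof.
elim: s alpha gamma => [|j0 s IH] alpha gamma /=.
  move=> _ H; exists (fun=> 0) => // i; rewrite big_nil.
  (* Testing with [c = gamma] makes the squared norm of [gamma] nonpositive. *)
  have /H : forall j, j \in [::] -> dot (alpha j) gamma <= 0 by [].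
  move=> le; have ge0 : 0 <= \sum_i gamma i ^+ 2.
    by apply: sumr_ge0 => k _; apply: sqr_ge0.
  have /eqP : \sum_i gamma i ^+ 2 = 0 by apply/le_anti; rewrite ge0 andbT.
  rewrite psumr_eq0 => [/allP/(_ i)|j _]; last exact: sqr_ge0.
  by rewrite mem_index_enum /= sqrf_eq0 => /(_ isT)/eqP.
case/andP=> j0s us H.
have [H0|] := pselect (forall c,
    (forall j, j \in s -> dot (alpha j) c <= 0) -> dot gamma c <= 0).
  have [lam lam0 lamE] := IH alpha gamma us H0.
  exists (fun j => if j == j0 then 0 else lam j) => [j|i]; first by case: ifP.
  rewrite big_cons eqxx mul0r add0r lamE; apply: eq_big_seq => j js.
  by case: eqP js j0s => // -> ->.
move/existsNP => [x /not_implyP[xs /negP]]; rewrite -ltNge => gx.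
have ax : 0 < dot (alpha j0) x.
  rewrite ltNge; apply/negP => ax; move: gx; rewrite ltNge H // => j.
  by rewrite inE => /orP[/eqP->|/xs].
pose y i := (dot (alpha j0) x)^-1 * x i.
have y0 : dot (alpha j0) y = 1 by rewrite dotZr mulVf // gt_eqF.
have ys j : j \in s -> dot (alpha j) y <= 0.
  by move=> js; rewrite dotZr pmulr_rle0 ?invr_gt0 // xs.
have gy : 0 < dot gamma y by rewrite dotZr mulr_gt0 ?invr_gt0.
have [||lam lam0 lamE] := IH (fun j i => alpha j i - dot (alpha j) y * alpha j0 i)
   (fun i => gamma i - dot gamma y * alpha j0 i) => //.
  (* [z] is the image of [c] under the adjoint projection, hence orthogonal to [alpha j0], so that
     [H] applies to it. *)
  move=> c cs; pose z i := c i - dot (alpha j0) c * y i.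
  have := H z; rewrite dotBl dotBr mulrC; apply=> j; rewrite inE.
  case/orP => [/eqP ->|js]; first by rewrite dotBr y0 mulr1 subrr.
  by have := cs j js; rewrite dotBl dotBr mulrC.
(* The collected coefficient of [alpha j0]; it is nonnegative because [gamma] is positive and the
   tail nonpositive on [y]. *)
pose l0 := dot gamma y - \sum_(j <- s) lam j * dot (alpha j) y.
exists (fun j => if j == j0 then l0 else lam j) => [j|i].
  case: ifP => // _; rewrite /l0 subr_ge0; apply: le_trans (ltW gy).
  rewrite big_seq; apply: sumr_le0 => k ks; exact: mulr_ge0_le0 (lam0 k) (ys k ks).
rewrite big_cons eqxx (eq_big_seq (fun j => lam j * alpha j i)); last first.
  by move=> j js; case: eqP js j0s => // -> ->.
have E : \sum_(j <- s) lam j * (alpha j i - dot (alpha j) y * alpha j0 i) =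
    \sum_(j <- s) lam j * alpha j i -
    (\sum_(j <- s) lam j * dot (alpha j) y) * alpha j0 i.
  by rewrite mulr_suml -sumrB; apply: eq_bigr => j _; ring.
by rewrite -[LHS](subrK (dot gamma y * alpha j0 i)) lamE E /l0; ring.
Qed.

End Farkas.

Lemma common_denominator (I : finType) (c : I -> rat) : (forall i, 0 <= c i)%R ->
  exists2 N : nat, 0 < N & exists w : I -> nat, forall i, ((w i)%:R = N%:R * c i)%R.
Proof.
move=> c0; pose den i := `|denq (c i)|%N.
have den_gt0 i : 0 < den i by rewrite absz_gt0 denq_eq0.
have denE i : ((den i)%:R * c i = `|numq (c i)|%N%:R)%R.
  rewrite /den -[X in (_ * X)%R]divq_num_den !pmulrn !gez0_abs ?numq_ge0 ?denq_ge0 //.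
  by rewrite mulrCA divff ?mulr1 // intr_eq0 denq_eq0.
exists (\prod_i den i); first exact: prodn_gt0.
exists (fun i => (\prod_(j | j != i) den j) * `|numq (c i)|%N) => i.
by rewrite [in RHS](bigD1 i) //= [in RHS]natrM natrM -denE; ring.
Qed.

(** * Fractional edge colourings *)

Section Coloring.
Variable G : sgraph.
Implicit Types (M : {set {set G}}) (e : {set G}).

Lemma edgesP e : reflect (exists u v, adj u v /\ e = [set u; v]) (e \in edges G).
Proof.
rewrite inE; apply: (iffP existsP) => [[u /existsP[v /andP[uv /eqP->]]]|].
  by exists u, v.
by move=> [u [v [uv ->]]]; exists u; apply/existsP; exists v; rewrite uv eqxx.
Qed.

Lemma adj_neq (u v : G) : adj u v -> u != v.
Proof. by apply: contraTneq => ->; rewrite adj_irrefl. Qed.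

Lemma card_edge e : e \in edges G -> #|e| = 2.
Proof. by case/edgesP => u [v [/adj_neq uv ->]]; rewrite cards2 uv. Qed.

Lemma sum_incident (w : {set G} -> nat) M : M \subset edges G ->
  \sum_v \sum_(e in M | v \in e) w e = 2 * \sum_(e in M) w e.
Proof.
move=> /subsetP sM; rewrite (exchange_big_dep (mem M)) /=; last by move=> v e _ /andP[].
rewrite big_distrr; apply: eq_bigr => e eM /=.
rewrite (eq_bigl (mem e)) => [|v]; last by rewrite eM.
by rewrite sum_nat_const card_edge ?sM.
Qed.

Lemma sum_star (R : nmodType) (w : {set G} -> R) (v : G) :
  (\sum_(e in edges G | v \in e) w e = \sum_(u | adj v u) w [set v; u])%R.
Proof.
transitivity (\sum_(u in [set u | adj v u]) w [set v; u])%R; last first.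
  by apply: eq_bigl => u; rewrite inE.
have inj : {in [set u | adj v u] &, injective (fun u => [set v; u])}.
  move=> a b; rewrite !inE => /adj_neq va /adj_neq vb ab.
  have := set22 v a; rewrite ab !inE eq_sym (negPf va) => /eqP //.
rewrite -(big_imset w inj); apply: eq_bigl => e.
apply/andP/imsetP => [[/edgesP[a [b [ab ->]]]]|[u]].
  rewrite !inE => /orP[]/eqP->; first by exists b; rewrite ?inE.
  by exists a; rewrite ?inE 1?adj_sym // setUC.
rewrite inE => vu ->; split; last exact: set21.
by apply/edgesP; exists v, u.
Qed.

Lemma card_star (v : G) : #|[set e in edges G | v \in e]| = degree v.
Proof.
rewrite -sum1_card /degree -sum1_card.
rewrite (eq_bigl (fun e => (e \in edges G) && (v \in e))) => [|e]; last by rewrite inE.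
by rewrite (sum_star (fun=> 1) v); apply: eq_bigl => u; rewrite inE.
Qed.

Section Weights.
Variable D : nat.
Hypothesis degG : forall v : G, degree v <= D.
Hypothesis denG : forall U : {set G}, U != set0 ->
  \sum_(u in U) #|[set v in U | adj u v]| <= D * #|U|.-1.

Lemma matching_nat_weight (w : {set G} -> nat) : exists2 M, M \in matchings G &
  (forall e, e \in M -> 0 < w e) /\
  \sum_(e in edges G) w e <= D * \sum_(e in M) w e.
Proof.
pose W (u v : G) := if adj u v then w [set u; v] else 0.
have symW : symmetric_weight W.
  by split=> [u v|v]; rewrite /W ?adj_irrefl // adj_sym setUC.
have adjW u v : 0 < W u v -> adj u v by rewrite /W; case: ifP.
have [s ms le] := weighted_matching degG denG symW adjW.
have [sK sW] := is_matchingP _ _ ms.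
pose M := [set [set v; s v] | v in [set v | s v != v]].
have mem_M v : s v != v -> [set v; s v] \in M by move=> sv; apply: imset_f; rewrite inE.
have memM e v : e \in M -> v \in e -> s v != v /\ e = [set v; s v].
  case/imsetP => x; rewrite inE => sx -> /set2P[]->; first by [].
  by rewrite sK eq_sym setUC.
have sM : M \subset edges G.
  apply/subsetP => e /imsetP[x]; rewrite inE => sx ->; apply/edgesP.
  by exists x, (s x); split=> //; apply/adjW/sW.
exists M; last split.
- rewrite inE sM; apply/trivIsetP => e f eM fM; apply: contraR => /pred0Pn[v /= /andP[ve vf]].
  by have [_ ->] := memM e v eM ve; have [_ ->] := memM f v fM vf.
- move=> e /imsetP[x]; rewrite inE => /sW; rewrite /W; case: ifP => // _ lt ->.
  exact: lt.
have tot : total_weight W = 2 * \sum_(e in edges G) w e.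
  rewrite -sum_incident //; apply: eq_bigr => v _.
  by rewrite (sum_star w v) [RHS]big_mkcond.
have wei : weight W s = 2 * \sum_(e in M) w e.
  rewrite -sum_incident //; apply: eq_bigr => v _.
  have [sv|sv] := eqVneq (s v) v.
    rewrite sv symW.2 big1 // => e /andP[eM ve].
    by have [] := memM e v eM ve; rewrite sv eqxx.
  rewrite /W adjW ?sW // (big_pred1 [set v; s v]) // => e /=.
  apply/andP/eqP => [[eM ve]|->]; first by have [] := memM e v eM ve.
  by split; [apply: mem_M | rewrite set21].
by move: le; rewrite tot wei mulnCA leq_pmul2l.
Qed.

(** Raise negative entries to 0 and clear denominators. The matching found uses only positive
    entries, where the truncation changes nothing. *)
Lemma matching_rat_weight (c : {set G} -> rat) : exists2 M, M \in matchings G &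
  (\sum_(e in edges G) c e <= D%:R * \sum_(e in M) c e)%R.
Proof.
have c0 e : (0 <= Num.max (c e) 0 :> rat)%R by rewrite le_max lexx orbT.
have [N N0 [w wE]] := common_denominator c0.
have [M mM [posM le]] := matching_nat_weight w.
exists M => //; apply: (@le_trans _ _ (\sum_(e in edges G) Num.max (c e) 0)%R).
  by apply: ler_sum => e _; rewrite le_max lexx.
rewrite -(@ler_pM2l _ N%:R%R) ?ltr0n // mulr_sumr mulrCA mulr_sumr.
move: le; rewrite -(ler_nat rat) natrM !natr_sum.
rewrite (eq_bigr _ (fun e _ => wE e)) (eq_bigr (fun e => N%:R * c e)%R (P := mem M)) //.
move=> e eM; have := posM e eM; rewrite -(ltr_nat rat) wE pmulr_rgt0 ?ltr0n //.
by rewrite lt_max ltxx orbF => /ltW /max_idPl ->.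
Qed.

(** Farkas' lemma with one vector per matching: the coordinate [Some e] encodes the equation at [e],
    and [None] the total weight. *)
Lemma rational_coloring : exists lam : {set {set G}} -> rat,
  [/\ forall M, (0 <= lam M)%R,
      forall e, e \in edges G -> (\sum_(M in matchings G | e \in M) lam M = 1)%R &
      (\sum_(M in matchings G) lam M = D%:R)%R].
Proof.
pose alpha M (o : option {set G}) : rat :=
  (if o is Some e then ((e \in edges G) && (e \in M))%:R else 1)%R.
pose gamma (o : option {set G}) : rat :=
  (if o is Some e then (e \in edges G)%:R else D%:R)%R.
have dotE (a : option {set G} -> rat) c : dot a c =
    (a None * c None + \sum_e a (Some e) * c (Some e))%R.
  rewrite /dot (bigD1 None) //=; congr (_ + _)%R.
  rewrite (reindex_omap Some id) => [|[]//]; apply: eq_bigl => e.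
  by rewrite /= eqxx.
have [||lam lam0 lamE] := @farkas _ _ _ (enum (matchings G)) alpha gamma.
- exact: enum_uniq.
(* For this [M], [gamma] paired with [c] is at most [D] times [alpha M] paired with [c]. *)
- move=> c H; have [M mM le] := matching_rat_weight (c \o Some).
  have sM : M \subset edges G by move: mM; rewrite inE => /andP[].
  have := H M; rewrite mem_enum !dotE /alpha /gamma => /(_ mM) leM.
  have E1 : (\sum_e (e \in edges G)%:R * c (Some e) =
             \sum_(e in edges G) c (Some e))%R.
    rewrite [RHS]big_mkcond; apply: eq_bigr => e _.
    by case: ifP; rewrite ?mul1r ?mul0r.
  have E2 : (\sum_e ((e \in edges G) && (e \in M))%:R * c (Some e) =
             \sum_(e in M) c (Some e))%R.
    rewrite [RHS]big_mkcond; apply: eq_bigr => e _.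
    case: ifP => [eM|_]; last by rewrite andbF mul0r.
    by rewrite (subsetP sM) //= ?eM mul1r.
  rewrite E1; rewrite E2 mul1r in leM.
  have := ler_wpM2l (ler0n rat D) leM; rewrite mulr0 mulrDr.
  by apply: le_trans; rewrite lerD2l.
exists lam; split=> // [e eE|].
  transitivity (gamma (Some e)); last by rewrite /gamma eE.
  rewrite lamE big_enum /= [LHS]big_mkcondr; apply: eq_bigr => M _.
  by rewrite eE; case: (e \in M); rewrite ?mulr1 ?mulr0.
rewrite -[RHS]/(gamma None) lamE big_enum /=.
by apply: eq_bigr => M _; rewrite mulr1.
Qed.

End Weights.

(** Add the equations of the edges at [v]: each matching occurs at most once. *)
Lemma degree_le_total (R : realType) (lam : {set {set G}} -> R) (v : G) :
  fractional_edge_coloring lam ->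
  ((degree v)%:R <= \sum_(M in matchings G) lam M)%R.
Proof.
move=> [lam0 lam1]; rewrite -card_star -sum1_card natr_sum.
rewrite (eq_bigr (fun e => \sum_(M in matchings G | e \in M) lam M)%R); last first.
  by move=> e; rewrite inE => /andP[eE _]; rewrite lam1.
rewrite (exchange_big_dep (mem (matchings G))) /=; last by move=> e M _ /andP[].
apply: ler_sum => M mM; rewrite sumr_const.
set n := #|_|; have : n <= 1.
  apply/card_le1_eqP => e f; rewrite -!topredE /= !inE.
  case/and3P => /andP[_ ve] _ eM /and3P[/andP[_ vf] _ fM].
  move: mM; rewrite inE => /andP[_ /trivIsetP tM]; apply: contraTeq vf => ef.
  by rewrite (disjointFr (tM e f eM fM _)) // eq_sym.
by case: n => [|[|]] // _; apply: lam0.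
Qed.

Lemma fractional_chromatic_index_max_degree (R : realType) :
  (forall U : {set G}, U != set0 ->
    \sum_(u in U) #|[set v in U | adj u v]| <= max_degree G * #|U|.-1) ->
  is_fractional_chromatic_index G ((max_degree G)%:R : R)%R.
Proof.
move=> denG; split=> [|lam lamC].
  have degG (v : G) : degree v <= max_degree G by apply: leq_bigmax.
  have [lam [lam0 lam1 lamD]] := rational_coloring degG denG.
  exists (fun M => ratr (lam M)); split.
    split=> [M _|e eE]; first by rewrite ler0q.
    by rewrite -rmorph_sum lam1 //= rmorph1.
  by rewrite -rmorph_sum lamD /= ratr_nat.
(* Without vertices the maximum degree is 0, and nonnegativity of the total suffices. *)
have [G0|/card_gt0P[v _]] := posnP #|G|.
  rewrite /max_degree big1 => [|v]; first by apply: sumr_ge0 => M /lamC.1.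
  by have := card0_eq G0 v.
have [|w maxw] := @bigop.eq_bigmax G (@degree G); first by apply/card_gt0P; exists v.
by rewrite /max_degree maxw; apply: degree_le_total.
Qed.

End Coloring.

Local Open Scope ring_scope.

Theorem theorem3 (R : realType) (G : sgraph) (k Delta : nat) :
  treewidth G = k ->
  max_degree G = Delta ->
  k%:R + Num.sqrt k%:R <= Delta%:R :> R ->
  is_fractional_chromatic_index G (Delta%:R : R).
Proof.
move=> twG <- le.
have kD : (k <= max_degree G)%N.
  by rewrite -(ler_nat R); apply: le_trans le; rewrite lerDl sqrtr_ge0.
pose d := (max_degree G - k)%N.
have Dkd : max_degree G = (k + d)%N by rewrite subnKC.
(* Cancelling [k] in the hypothesis leaves [sqrt k <= d], which is then squared. *)
have kd : (k <= d ^ 2)%N.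
  move: le; rewrite Dkd natrD lerD2l => le.
  rewrite -(ler_nat R) natrX -(sqr_sqrtr (ler0n R k)).
  by rewrite lerXn2r ?nnegrE ?sqrtr_ge0.
have decG : has_tree_decomposition_of_width G k.
  by move: twG; rewrite /treewidth; case: ex_minnP => m /asboolP decG _ <-.
apply: fractional_chromatic_index_max_degree => U; rewrite Dkd.
apply: treewidth_density decG kd _ U => v; rewrite -Dkd.
exact: leq_bigmax.
Qed.
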